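(* Let $\mathsf{C}$ be an a.s.-compatibly representable Markov category with distribution functor $P$ and for which conditionals exist. Then for any $P$-algebra $e\colon PA\to A$ in $\mathsf{C}_{\det}$ and any morphisms $p,q\colon\Theta\to A$ in $\mathsf{C}$, the following two conditions are equivalent: (i) There exists a morphism $r\colon\Theta\to PA$ in $\mathsf{C}$ such that $\mathrm{samp}_A\circ r=p$ and $e\circ r=q$. (ii) There exists a $q$-dilation $t\colon\Theta\otimes A\to A$ (with respect to $e$) which converts $q$ to $p$, in the sense that $$t\circ(\mathrm{id}_\Theta\otimes q)\circ\mathrm{copy}_\Theta=p.$$
   Context: Coherence isomorphisms of monoidal categories are suppressed. A Markov category is a symmetric monoidal category $(\mathsf{C},\otimes,I)$ whose unit $I$ is terminal (write $\mathrm{del}_X \colon X \to I$), in which every object $X$ carries a distinguished morphism $\mathrm{copy}_X \colon X \to X\otimes X$ making $(X,\mathrm{copy}_X,\mathrm{del}_X)$ a commutative comonoid, and such that $\mathrm{copy}_{X\otimes Y} = (\mathrm{id}_X\otimes \mathrm{swap}_{X,Y}\otimes \mathrm{id}_Y)\circ(\mathrm{copy}_X\otimes \mathrm{copy}_Y)$. A morphism $f\colon X\to Y$ is deterministic if $\mathrm{copy}_Y\circ f=(f\otimes f)\circ \mathrm{copy}_X$; deterministic morphisms form a subcategory $\mathsf{C}_{\det}$. Conditionals: a conditional of $f\colon A\to X\otimes Y$ with respect to $X$ is a morphism $f_{|X}\colon X\otimes A\to Y$ with $f=(\mathrm{id}_X\otimes f_{|X})\circ(\mathrm{copy}_X\otimes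 \mathrm{id}_A)\circ(((\mathrm{id}_X\otimes \mathrm{del}_Y)\circ f)\otimes \mathrm{id}_A)\circ \mathrm{copy}_A$. Conditionals exist in $\mathsf{C}$ if they exist for all such $f$. Almost sure equality: for $h\colon A\to X$ and $f,g\colon X\to Y$, write $f=_{h\text{-a.s.}}g$ if $(\mathrm{id}_X\otimes f)\circ \mathrm{copy}_X\circ h=(\mathrm{id}_X\otimes g)\circ \mathrm{copy}_X\circ h$. Representability: $\mathsf{C}$ is representable if every object $X$ has a distribution object, i.e. an object $PX$ with a morphism $\mathrm{samp}_X\colon PX\to X$ such that $\mathrm{samp}_X\circ -\colon \mathsf{C}_{\det}(A,PX)\to\mathsf{C}(A,X)$ is a bijection for all $A$. Its inverse is written $f\mapsto f^\sharp$; $\delta_X:=(\mathrm{id}_X)^\sharp$. $P$ is a functor $\mathsf{C}\to\mathsf{C}_{\det}$ (the distribution functor), $Pf=(f\circ\mathrm{samp}_X)^\sharp$ for $f\colon X\to Y$, right adjoint to the inclusion $\mathsf{C}_{\det}\hookrightarrow\mathsf{C}$. Its restriction to $\mathsf{C}_{\det}$ is a monad with unit $\delta$ and multiplication $P(\mathrm{samp}_X)\colon PPX\to PX$; ''$P$-algebra'' means (Eilenberg–Moore) algebra of this monad on $\mathsf{C}_{\det}$. $\mathsf{C}$ is a.s.-compatibly representable if it is representable and for all $p\colon B\to A$ and $f,g\colon A\to X$: $f^\sharp=_{p\text{-a.s.}}g^\sharp$ if and only if $f=_{p\text{-a.s.}}g$. Dilation: given a $P$-algebra $e\colon PA\to A$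 and $q\colon\Theta\to A$, a morphism $t\colon\Theta\otimes A\to A$ is a $q$-dilation with respect to $e$ if $$(\mathrm{id}_A\otimes(e\circ t^\sharp))\circ(\mathrm{swap}_{\Theta,A}\otimes\mathrm{id}_A)\circ(\mathrm{id}_\Theta\otimes\mathrm{copy}_A)\circ(\mathrm{id}_\Theta\otimes q)\circ\mathrm{copy}_\Theta=\mathrm{copy}_A\circ q.$$ *)

(* Defs.v *)
From Stdlib Require Import ssreflect ProofIrrelevance.

Set Implicit Arguments.
Unset Strict Implicit.
Unset Printing Implicit Defensive.

Declare Scope ob_scope.
Declare Scope hom_scope.
Delimit Scope ob_scope with ob.
Delimit Scope hom_scope with hom.
Open Scope hom_scope.

Reserved Notation "A ~> B" (at level 90, right associativity).
Reserved Notation "g ∘ f" (at level 40, left associativity).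
Reserved Notation "x ⊗ y" (at level 35, right associativity).

(** * Categories, functors, monads *)

Record category := Category {
  ob :> Type;
  hom : ob -> ob -> Type;
  idm : forall A, hom A A;
  comp : forall A B C, hom B C -> hom A B -> hom A C;
  comp_id_l : forall A B (f : hom A B), comp (idm B) f = f;
  comp_id_r : forall A B (f : hom A B), comp f (idm A) = f;
  comp_assoc : forall A B C D (h : hom C D) (g : hom B C) (f : hom A B),
    comp h (comp g f) = comp (comp h g) f
}.

Bind Scope ob_scope with ob.
Bind Scope hom_scope with hom.
Arguments hom {c} A%_ob B%_ob.
Arguments idm {c} A%_ob.
Arguments comp {c A B C} g%_hom f%_hom : rename.
Notation "A ~> B" := (hom A B) : type_scope.
Notation "g ∘ f" := (comp g f) : hom_scope.

Record functor (C D : category) := Functor {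
  fob :> C -> D;
  fmap : forall A B : C, (A ~> B) -> (fob A ~> fob B);
  fmap_id : forall A, fmap (idm A) = idm (fob A);
  fmap_comp : forall (A B E : C) (g : B ~> E) (f : A ~> B),
    fmap (g ∘ f) = fmap g ∘ fmap f
}.
Arguments fmap {C D} f0 {A B} f%_hom : rename.

Lemma functor_comp_id (C D E : category) (G : functor D E) (F : functor C D) (A : C) :
  fmap G (fmap F (idm A)) = idm (G (F A)).
Proof. by rewrite !fmap_id. Qed.

Lemma functor_comp_comp (C D E : category) (G : functor D E) (F : functor C D)
    (X Y Z : C) (g : Y ~> Z) (f : X ~> Y) :
  fmap G (fmap F (g ∘ f)) = fmap G (fmap F g) ∘ fmap G (fmap F f).
Proof. by rewrite !fmap_comp. Qed.

Definition functor_comp (C D E : category) (G : functor D E) (F : functor C D) :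
    functor C E :=
  @Functor C E (fun A => G (F A)) (fun A B f => fmap G (fmap F f))
    (functor_comp_id G F) (functor_comp_comp G F).

Record monad (C : category) := Monad {
  endo :> functor C C;
  munit : forall A : C, A ~> endo A;
  mmult : forall A : C, endo (endo A) ~> endo A;
  munit_nat : forall (A B : C) (f : A ~> B), munit B ∘ f = fmap endo f ∘ munit A;
  mmult_nat : forall (A B : C) (f : A ~> B),
    mmult B ∘ fmap endo (fmap endo f) = fmap endo f ∘ mmult A;
  mmult_unit_l : forall A, mmult A ∘ munit (endo A) = idm (endo A);
  mmult_unit_r : forall A, mmult A ∘ fmap endo (munit A) = idm (endo A);
  mmult_assoc : forall A, mmult A ∘ mmult (endo A) = mmult A ∘ fmap endo (mmult A)
}.

Definition is_algebra (C : category) (T : monad C) (A : C) (e : T A ~> A) : Prop :=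
  e ∘ munit T A = idm A /\ e ∘ mmult T A = e ∘ fmap T e.

(** * Symmetric monoidal categories *)

Record symmetric_monoidal := SymmetricMonoidal {
  smcat :> category;
  tens : smcat -> smcat -> smcat
    where "X ⊗ Y" := (tens X Y) : ob_scope;
  tensm : forall A B X Y : smcat, (A ~> B) -> (X ~> Y) -> (A ⊗ X ~> B ⊗ Y)
    where "f ⊗ g" := (tensm f g) : hom_scope;
  tens_unit : smcat;
  tensm_id : forall A B : smcat, idm A ⊗ idm B = idm (A ⊗ B);
  tensm_comp : forall (A B C X Y Z : smcat)
      (g : B ~> C) (f : A ~> B) (k : Y ~> Z) (h : X ~> Y),
    (g ∘ f) ⊗ (k ∘ h) = (g ⊗ k) ∘ (f ⊗ h);
  assoc : forall A B C : smcat, (A ⊗ B) ⊗ C ~> A ⊗ (B ⊗ C);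
  assocV : forall A B C : smcat, A ⊗ (B ⊗ C) ~> (A ⊗ B) ⊗ C;
  assocK : forall A B C, assocV A B C ∘ assoc A B C = idm ((A ⊗ B) ⊗ C);
  assocVK : forall A B C, assoc A B C ∘ assocV A B C = idm (A ⊗ (B ⊗ C));
  assoc_nat : forall (A B C A' B' C' : smcat)
      (f : A ~> A') (g : B ~> B') (h : C ~> C'),
    assoc A' B' C' ∘ ((f ⊗ g) ⊗ h) = (f ⊗ (g ⊗ h)) ∘ assoc A B C;
  lunit : forall A : smcat, tens_unit ⊗ A ~> A;
  lunitV : forall A : smcat, A ~> tens_unit ⊗ A;
  lunitK : forall A, lunitV A ∘ lunit A = idm (tens_unit ⊗ A);
  lunitVK : forall A, lunit A ∘ lunitV A = idm A;
  lunit_nat : forall (A B : smcat) (f : A ~> B),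
    lunit B ∘ (idm tens_unit ⊗ f) = f ∘ lunit A;
  runit : forall A : smcat, A ⊗ tens_unit ~> A;
  runitV : forall A : smcat, A ~> A ⊗ tens_unit;
  runitK : forall A, runitV A ∘ runit A = idm (A ⊗ tens_unit);
  runitVK : forall A, runit A ∘ runitV A = idm A;
  runit_nat : forall (A B : smcat) (f : A ~> B),
    runit B ∘ (f ⊗ idm tens_unit) = f ∘ runit A;
  swap : forall A B : smcat, A ⊗ B ~> B ⊗ A;
  swapK : forall A B, swap B A ∘ swap A B = idm (A ⊗ B);
  swap_nat : forall (A B A' B' : smcat) (f : A ~> A') (g : B ~> B'),
    swap A' B' ∘ (f ⊗ g) = (g ⊗ f) ∘ swap A B;
  triangle : forall A B : smcat,
    (idm A ⊗ lunit B) ∘ assoc A tens_unit B = runit A ⊗ idm B;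
  pentagon : forall A B C D : smcat,
    assoc A B (C ⊗ D) ∘ assoc (A ⊗ B) C D =
    (idm A ⊗ assoc B C D) ∘ assoc A (B ⊗ C) D ∘ (assoc A B C ⊗ idm D);
  hexagon : forall A B C : smcat,
    assoc B C A ∘ swap A (B ⊗ C) ∘ assoc A B C =
    (idm B ⊗ swap A C) ∘ assoc B A C ∘ (swap A B ⊗ idm C)
}.

Arguments tens {s} X%_ob Y%_ob : rename.
Arguments tensm {s A B X Y} f%_hom g%_hom : rename.
Arguments tens_unit {s}.
Arguments assoc {s} A%_ob B%_ob C%_ob : rename.
Arguments assocV {s} A%_ob B%_ob C%_ob : rename.
Arguments lunit {s} A%_ob : rename.
Arguments lunitV {s} A%_ob : rename.
Arguments runit {s} A%_ob : rename.
Arguments runitV {s} A%_ob : rename.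
Arguments swap {s} A%_ob B%_ob : rename.
Notation "X ⊗ Y" := (tens X Y) : ob_scope.
Notation "f ⊗ g" := (tensm f g) : hom_scope.

(** The symmetry [id ⊗ swap ⊗ id] of the two middle factors. *)
Definition swap_middle (C : symmetric_monoidal) (X X' Y Y' : C) :
    (X ⊗ X') ⊗ (Y ⊗ Y') ~> (X ⊗ Y) ⊗ (X' ⊗ Y') :=
  assocV X Y (X' ⊗ Y')
  ∘ (idm X ⊗ (assoc Y X' Y' ∘ (swap X' Y ⊗ idm Y') ∘ assocV X' Y Y'))
  ∘ assoc X X' (Y ⊗ Y').
Arguments swap_middle {C} X%_ob X'%_ob Y%_ob Y'%_ob.

(** * Markov categories *)

Record markov_category := MarkovCategory {
  mksm :> symmetric_monoidal;
  del : forall X : mksm, X ~> tens_unit;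
  del_unique : forall (X : mksm) (f : X ~> tens_unit), f = del X;
  copy : forall X : mksm, X ~> X ⊗ X;
  copy_assoc : forall X : mksm,
    assoc X X X ∘ (copy X ⊗ idm X) ∘ copy X = (idm X ⊗ copy X) ∘ copy X;
  copy_del_l : forall X : mksm, lunit X ∘ (del X ⊗ idm X) ∘ copy X = idm X;
  copy_del_r : forall X : mksm, runit X ∘ (idm X ⊗ del X) ∘ copy X = idm X;
  copy_comm : forall X : mksm, swap X X ∘ copy X = copy X;
  copy_tens : forall X Y : mksm,
    copy (X ⊗ Y) = swap_middle X X Y Y ∘ (copy X ⊗ copy Y)
}.
Arguments del {m} X%_ob : rename.
Arguments copy {m} X%_ob : rename.

Definition deterministic (C : markov_category) (X Y : C) (f : X ~> Y) : Prop :=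
  copy Y ∘ f = (f ⊗ f) ∘ copy X.

Lemma deterministic_id (C : markov_category) (X : C) : deterministic (idm X).
Proof. by rewrite /deterministic tensm_id comp_id_l comp_id_r. Qed.

Lemma deterministic_comp (C : markov_category) (X Y Z : C) (g : Y ~> Z) (f : X ~> Y) :
  deterministic g -> deterministic f -> deterministic (g ∘ f).
Proof.
rewrite /deterministic => hg hf.
by rewrite comp_assoc hg -comp_assoc hf comp_assoc tensm_comp.
Qed.

Record det_hom (C : markov_category) (X Y : C) := DetHom {
  det_mor :> X ~> Y;
  det_morP : deterministic det_mor
}.

Lemma det_hom_eq (C : markov_category) (X Y : C) (f g : det_hom X Y) :
  det_mor f = det_mor g -> f = g.
Proof.
case: f g => f hf [g hg] /= E; subst g.
by rewrite (proof_irrelevance _ hf hg).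
Qed.

Definition det_id (C : markov_category) (X : C) : det_hom X X :=
  DetHom (deterministic_id X).

Definition det_comp (C : markov_category) (X Y Z : C)
    (g : det_hom Y Z) (f : det_hom X Y) : det_hom X Z :=
  DetHom (deterministic_comp (det_morP g) (det_morP f)).

(** The wide subcategory of deterministic morphisms. *)
Definition det_cat (C : markov_category) : category.
Proof.
refine (@Category C (@det_hom C) (@det_id C) (@det_comp C) _ _ _).
- by move=> A B f; apply: det_hom_eq; apply: comp_id_l.
- by move=> A B f; apply: det_hom_eq; apply: comp_id_r.
- by move=> A B D E h g f; apply: det_hom_eq; apply: comp_assoc.
Defined.

Definition det_incl (C : markov_category) : functor (det_cat C) C :=
  @Functor (det_cat C) C (fun A => A) (fun A B f => det_mor f)
    (fun A => eq_refl) (fun A B E g f => eq_refl).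

(** The coherence isomorphism [runit] identifies [X ⊗ I] with [X]. *)
Definition is_conditional (C : markov_category) (A X Y : C)
    (f : A ~> X ⊗ Y) (c : X ⊗ A ~> Y) : Prop :=
  f = (idm X ⊗ c) ∘ assoc X X A ∘ (copy X ⊗ idm A)
      ∘ ((runit X ∘ (idm X ⊗ del Y) ∘ f) ⊗ idm A) ∘ copy A.

Definition has_conditionals (C : markov_category) : Prop :=
  forall (A X Y : C) (f : A ~> X ⊗ Y), exists c : X ⊗ A ~> Y, is_conditional f c.

Definition as_eq (C : markov_category) (A X Y : C) (h : A ~> X) (f g : X ~> Y) : Prop :=
  (idm X ⊗ f) ∘ copy X ∘ h = (idm X ⊗ g) ∘ copy X ∘ h.

(** * Representability *)

(** A choice of distribution objects; [sharp] is the inverse of the bijection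
    [samp ∘ -] from deterministic morphisms [A ~> P X] to morphisms [A ~> X]. *)
Record representation (C : markov_category) := Representation {
  dist : C -> C;
  samp : forall X : C, dist X ~> X;
  sharp : forall A X : C, (A ~> X) -> det_hom A (dist X);
  samp_sharp : forall (A X : C) (f : A ~> X), samp X ∘ sharp f = f;
  sharp_samp : forall (A X : C) (g : det_hom A (dist X)), sharp (samp X ∘ g) = g
}.
Arguments dist {C} r X%_ob.
Arguments samp {C} r X%_ob.
Arguments sharp {C} r {A X} f%_hom.

Definition as_compatible (C : markov_category) (R : representation C) : Prop :=
  forall (B A X : C) (p : B ~> A) (f g : A ~> X),
    as_eq p (sharp R f) (sharp R g) <-> as_eq p f g.

Section DistributionMonad.
Variables (C : markov_category) (R : representation C).

Lemma samp_inj (A X : C) (f g : det_hom A (dist R X)) :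
  samp R X ∘ f = samp R X ∘ g -> f = g.
Proof. by move=> E; rewrite -(sharp_samp f) E sharp_samp. Qed.

Definition dist_map (X Y : C) (f : X ~> Y) : det_hom (dist R X) (dist R Y) :=
  sharp R (f ∘ samp R X).

Lemma samp_dist_map (X Y : C) (f : X ~> Y) :
  samp R Y ∘ dist_map f = f ∘ samp R X.
Proof. exact: samp_sharp. Qed.

Definition dist_functor : functor C (det_cat C).
Proof.
refine (@Functor C (det_cat C) (dist R) dist_map _ _).
- by move=> A; apply: samp_inj; rewrite samp_dist_map comp_id_l /= comp_id_r.
- move=> A B E g f; apply: samp_inj.
  by rewrite samp_dist_map /= comp_assoc samp_dist_map -!comp_assoc samp_dist_map.
Defined.

Definition delta (X : C) : det_hom X (dist R X) := sharp R (idm X).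

Definition dist_monad : monad (det_cat C).
Proof.
refine (@Monad (det_cat C) (functor_comp dist_functor (det_incl C))
          delta (fun X => dist_map (samp R X)) _ _ _ _ _).
- move=> A B f; apply: samp_inj => /=.
  by rewrite !comp_assoc samp_sharp samp_dist_map -comp_assoc samp_sharp
    comp_id_l comp_id_r.
- move=> A B f; apply: samp_inj => /=.
  rewrite !comp_assoc !samp_dist_map -!comp_assoc samp_dist_map.
  by rewrite comp_assoc samp_dist_map -!comp_assoc samp_dist_map.
- move=> A; apply: samp_inj => /=.
  by rewrite comp_assoc samp_dist_map -comp_assoc samp_sharp.
- move=> A; apply: samp_inj => /=.
  by rewrite comp_assoc samp_dist_map -comp_assoc samp_dist_map comp_assoc
    samp_sharp comp_id_l comp_id_r.
- move=> A; apply: samp_inj => /=.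
  rewrite !comp_assoc !samp_dist_map -!comp_assoc.
  by rewrite !samp_dist_map !comp_assoc samp_dist_map.
Defined.

End DistributionMonad.
Arguments dist_map {C} R {X Y} f%_hom.
Arguments delta {C} R X%_ob.

(** * Dilations *)

Definition is_dilation (C : markov_category) (R : representation C) (A Theta : C)
    (e : dist R A ~> A) (q : Theta ~> A) (t : Theta ⊗ A ~> A) : Prop :=
  (idm A ⊗ (e ∘ sharp R t)) ∘ assoc A Theta A ∘ (swap Theta A ⊗ idm A)
    ∘ assocV Theta A A ∘ (idm Theta ⊗ copy A) ∘ (idm Theta ⊗ q) ∘ copy Theta
  = copy A ∘ q.

(* Main.v *)
From Stdlib Require Import ssreflect.
Require Import Defs.

Set Implicit Arguments.
Unset Strict Implicit.
Unset Printing Implicit Defensive.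

(** Given [r], let [c] be a conditional of [(e ⊗ id) ∘ copy ∘ r] with respect
    to [A], read as a morphism [Θ ⊗ A ~> P A] by precomposing with the symmetry;
    the dilation is [t = samp ∘ c].  Since [e] is deterministic, [e ∘ c] is
    almost surely equal to the projection [Θ ⊗ A ~> A].  By the algebra law,
    [e ∘ t^♯ = e ∘ (e ∘ c)^♯], and a.s.-compatibility turns [(e ∘ c)^♯] into
    [delta] of the projection, so [e ∘ t^♯] is almost surely the projection,
    which is the dilation property.  Conversely, a dilation [t] yields
    [r = t^♯ ∘ (id ⊗ q) ∘ copy], and [e ∘ r = q] is a marginal of the dilation
    property. *)

(** * Rewriting modulo associativity, and cancellation of isomorphisms *)

Section Category.
Variable C : category.

Lemma reassoc (X Y Z : C) (g : Y ~> Z) (f : X ~> Y) (h : X ~> Z) :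
  g ∘ f = h -> forall (W : C) (x : W ~> X), g ∘ (f ∘ x) = h ∘ x.
Proof. by move=> <- W x; rewrite comp_assoc. Qed.

Lemma cancel_left (X Y Z : C) (i : Y ~> Z) (j : Z ~> Y) (f g : X ~> Y) :
  j ∘ i = idm Y -> i ∘ f = i ∘ g -> f = g.
Proof. by move=> ji E; rewrite -(comp_id_l f) -ji -comp_assoc E comp_assoc ji comp_id_l. Qed.

Lemma cancel_right (X Y Z : C) (i : X ~> Y) (j : Y ~> X) (f g : Y ~> Z) :
  i ∘ j = idm Y -> f ∘ i = g ∘ i -> f = g.
Proof. by move=> ij E; rewrite -(comp_id_r f) -ij comp_assoc E -comp_assoc ij comp_id_r. Qed.

End Category.

(** * Coherence for units, symmetries and the middle-four interchange *)

Section Monoidal.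
Variable C : symmetric_monoidal.
Local Notation I := (@tens_unit C).

Lemma tensm_idl_comp (A X Y Z : C) (g : Y ~> Z) (f : X ~> Y) :
  idm A ⊗ (g ∘ f) = (idm A ⊗ g) ∘ (idm A ⊗ f).
Proof. by rewrite -tensm_comp comp_id_l. Qed.

Lemma tensm_idr_comp (A X Y Z : C) (g : Y ~> Z) (f : X ~> Y) :
  (g ∘ f) ⊗ idm A = (g ⊗ idm A) ∘ (f ⊗ idm A).
Proof. by rewrite -tensm_comp comp_id_l. Qed.

(** Tensoring with the unit is faithful, being naturally isomorphic to the identity functor via
    [lunit]. *)
Lemma tensm_unit_inj_l (X Y : C) (f g : X ~> Y) : idm I ⊗ f = idm I ⊗ g -> f = g.
Proof.
move=> E; apply: (cancel_right (lunitVK X)).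
by rewrite -!lunit_nat E.
Qed.

Lemma tensm_unit_inj_r (X Y : C) (f g : X ~> Y) : f ⊗ idm I = g ⊗ idm I -> f = g.
Proof.
move=> E; apply: (cancel_right (runitVK X)).
by rewrite -!runit_nat E.
Qed.

Lemma assocV_nat (A B D A' B' D' : C) (f : A ~> A') (g : B ~> B') (h : D ~> D') :
  assocV A' B' D' ∘ (f ⊗ (g ⊗ h)) = ((f ⊗ g) ⊗ h) ∘ assocV A B D.
Proof.
apply: (cancel_left (assocK A' B' D')).
rewrite comp_assoc assocVK comp_id_l comp_assoc assoc_nat.
by rewrite -comp_assoc assocVK comp_id_r.
Qed.

Lemma triangleV (A B : C) :
  (runit A ⊗ idm B) ∘ assocV A I B = idm A ⊗ lunit B.
Proof. by rewrite -triangle -comp_assoc assocVK comp_id_r. Qed.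

(** Kelly's argument: by faithfulness it suffices to check the equation tensored with [I].
    Precomposing with the associators in [iso] exposes one side of the pentagon for [I, I, A, B],
    and the triangles finish. *)
Lemma lunit_tens (A B : C) :
  lunit (A ⊗ B) ∘ assoc I A B = lunit A ⊗ idm B.
Proof.
apply: tensm_unit_inj_l.
have iso : (assoc I (I ⊗ A) B ∘ (assoc I I A ⊗ idm B))
    ∘ ((assocV I I A ⊗ idm B) ∘ assocV I (I ⊗ A) B) = idm _.
  rewrite -comp_assoc (reassoc (eq_sym (tensm_idr_comp _ _ _))) assocVK tensm_id.
  by rewrite comp_id_l assocVK.
apply: (cancel_right iso).
rewrite tensm_idl_comp -comp_assoc (comp_assoc (idm I ⊗ assoc I A B)) -pentagon.
rewrite comp_assoc triangle -(tensm_id A B) -assoc_nat -triangle tensm_idr_comp.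
by rewrite comp_assoc assoc_nat -comp_assoc.
Qed.

Lemma lunit_tensV (A B : C) :
  (lunit A ⊗ idm B) ∘ assocV I A B = lunit (A ⊗ B).
Proof. by rewrite -lunit_tens -comp_assoc assocVK comp_id_r. Qed.

(** The hexagon for [A, I, I], followed by [lunit], collapses to this equation tensored with [I] and
    postcomposed with the invertible [swap A I]. *)
Lemma lunit_swap (A : C) : lunit A ∘ swap A I = runit A.
Proof.
apply: tensm_unit_inj_r; apply: (cancel_left (swapK A I)).
have := f_equal (comp (lunit (I ⊗ A))) (hexagon A I I).
rewrite -!comp_assoc (reassoc (lunit_tens _ _)) (reassoc (lunit_nat _)) -!comp_assoc.
rewrite (reassoc (lunit_tens _ _)) -tensm_idr_comp.
by rewrite (reassoc (eq_sym (swap_nat _ _))) -comp_assoc triangle.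
Qed.

Lemma runit_swap (A : C) : runit A ∘ swap I A = lunit A.
Proof. by rewrite -lunit_swap -comp_assoc swapK comp_id_r. Qed.

(* The lock prevents associativity rewriting from unfolding the composition. *)
Definition swap_left (X Y Z : C) : X ⊗ (Y ⊗ Z) ~> Y ⊗ (X ⊗ Z) :=
  locked (assoc Y X Z ∘ (swap X Y ⊗ idm Z) ∘ assocV X Y Z).

Lemma swap_leftE (X Y Z : C) :
  swap_left X Y Z = assoc Y X Z ∘ (swap X Y ⊗ idm Z) ∘ assocV X Y Z.
Proof. by rewrite /swap_left -lock. Qed.

Lemma swap_middleE (X X' Y Y' : C) :
  swap_middle X X' Y Y'
  = assocV X Y (X' ⊗ Y') ∘ (idm X ⊗ swap_left X' Y Y') ∘ assoc X X' (Y ⊗ Y').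
Proof. by rewrite swap_leftE. Qed.

Lemma swap_left_nat (X Y Z X' Y' Z' : C) (f : X ~> X') (g : Y ~> Y') (h : Z ~> Z') :
  swap_left X' Y' Z' ∘ (f ⊗ (g ⊗ h)) = (g ⊗ (f ⊗ h)) ∘ swap_left X Y Z.
Proof.
rewrite !swap_leftE -!comp_assoc assocV_nat (comp_assoc _ _ (assocV X Y Z)).
rewrite -tensm_comp swap_nat comp_id_l -(comp_id_r h) tensm_comp comp_id_r.
by rewrite -!comp_assoc (reassoc (assoc_nat _ _ _)) -!comp_assoc.
Qed.

Lemma swap_left_unit (Y Z : C) : (idm Y ⊗ lunit Z) ∘ swap_left I Y Z = lunit (Y ⊗ Z).
Proof.
rewrite !swap_leftE !comp_assoc triangle -tensm_idr_comp runit_swap.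
exact: lunit_tensV.
Qed.

Lemma lunit_swap_left (X Z : C) : lunit (X ⊗ Z) ∘ swap_left X I Z = idm X ⊗ lunit Z.
Proof.
rewrite !swap_leftE !comp_assoc lunit_tens -tensm_idr_comp lunit_swap.
exact: triangleV.
Qed.

Lemma swap_left_swap (X Y Z : C) :
  (idm Y ⊗ swap X Z) ∘ swap_left X Y Z = assoc Y Z X ∘ swap X (Y ⊗ Z).
Proof.
rewrite !swap_leftE !comp_assoc -hexagon -comp_assoc assocVK.
by rewrite comp_id_r.
Qed.

(** The coherence behind determinism of [proj2]: once the first factor is discarded, the interchange
    in [copy_tens] disappears. *)
Lemma swap_middle_unit (Y Z : C) :
  (lunit Y ⊗ lunit Z) ∘ swap_middle I I Y Z = lunit (Y ⊗ Z) ∘ (lunit I ⊗ idm (Y ⊗ Z)).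
Proof.
have -> : lunit Y ⊗ lunit Z = (idm Y ⊗ lunit Z) ∘ (lunit Y ⊗ idm (I ⊗ Z)).
  by rewrite -tensm_comp comp_id_l comp_id_r.
rewrite !swap_middleE -!comp_assoc.
rewrite (reassoc (lunit_tensV _ _)) (reassoc (lunit_nat _)) -!comp_assoc.
by rewrite lunit_tens (reassoc (swap_left_unit _ _)).
Qed.

Lemma swap_middle_nat (X X' Y Y' U U' V V' : C)
    (f : X ~> U) (f' : X' ~> U') (g : Y ~> V) (g' : Y' ~> V') :
  swap_middle U U' V V' ∘ ((f ⊗ f') ⊗ (g ⊗ g'))
  = ((f ⊗ g) ⊗ (f' ⊗ g')) ∘ swap_middle X X' Y Y'.
Proof.
rewrite !swap_middleE -!comp_assoc.
rewrite assoc_nat (comp_assoc _ _ (assoc _ _ _)) -tensm_comp swap_left_nat comp_id_l.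
rewrite -{1}(comp_id_r f) tensm_comp -comp_assoc.
by rewrite (reassoc (assocV_nat _ _ _)) -comp_assoc.
Qed.

End Monoidal.

(** * Pairings, the second projection and almost sure equality *)

Section Markov.
Variable C : markov_category.
Local Notation I := (@tens_unit C).

(** Both components get a copy of the same input and are conditionally independent given it. This is
    not a cartesian pairing: precomposition distributes over it only for deterministic morphisms in
    general. *)
Definition pair (W X Y : C) (f : W ~> X) (g : W ~> Y) : W ~> X ⊗ Y :=
  locked ((f ⊗ g) ∘ copy W).

Lemma pairE (W X Y : C) (f : W ~> X) (g : W ~> Y) : pair f g = (f ⊗ g) ∘ copy W.
Proof. by rewrite /pair -lock. Qed.

Lemma tensm_pair (W X Y X' Y' : C) (h : X ~> X') (k : Y ~> Y')
    (f : W ~> X) (g : W ~> Y) :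
  (h ⊗ k) ∘ pair f g = pair (h ∘ f) (k ∘ g).
Proof. by rewrite !pairE tensm_comp comp_assoc. Qed.

Lemma copy_pair (W : C) : copy W = pair (idm W) (idm W).
Proof. by rewrite !pairE tensm_id comp_id_l. Qed.

Lemma swap_pair (W X Y : C) (f : W ~> X) (g : W ~> Y) :
  swap X Y ∘ pair f g = pair g f.
Proof. by rewrite !pairE comp_assoc swap_nat -comp_assoc copy_comm. Qed.

Lemma assoc_pair (W X Y Z : C) (f : W ~> X) (g : W ~> Y) (h : W ~> Z) :
  assoc X Y Z ∘ pair (pair f g) h = pair f (pair g h).
Proof.
have -> : pair (pair f g) h = ((f ⊗ g) ⊗ h) ∘ ((copy W ⊗ idm W) ∘ copy W).
  by rewrite !pairE comp_assoc -tensm_comp comp_id_r.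
have -> : pair f (pair g h) = (f ⊗ (g ⊗ h)) ∘ ((idm W ⊗ copy W) ∘ copy W).
  by rewrite !pairE comp_assoc -tensm_comp comp_id_r.
by rewrite -copy_assoc -!comp_assoc (reassoc (assoc_nat _ _ _)) -comp_assoc.
Qed.

Lemma lunit_pair (W X : C) (f : W ~> X) : lunit X ∘ pair (del W) f = f.
Proof.
have -> : pair (del W) f = (idm I ⊗ f) ∘ ((del W ⊗ idm W) ∘ copy W).
  by rewrite !pairE comp_assoc -tensm_comp comp_id_l comp_id_r.
by rewrite (reassoc (lunit_nat _)) -comp_assoc (comp_assoc (lunit W)) copy_del_l comp_id_r.
Qed.

Lemma runit_pair (W X : C) (f : W ~> X) : runit X ∘ pair f (del W) = f.
Proof.
have -> : pair f (del W) = (f ⊗ idm I) ∘ ((idm W ⊗ del W) ∘ copy W).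
  by rewrite !pairE comp_assoc -tensm_comp comp_id_l comp_id_r.
by rewrite (reassoc (runit_nat _)) -comp_assoc (comp_assoc (runit W)) copy_del_r comp_id_r.
Qed.

Lemma del_comp (X Y : C) (f : X ~> Y) : del Y ∘ f = del X.
Proof. exact: del_unique. Qed.

Definition proj2 (X Y : C) : X ⊗ Y ~> Y := locked (lunit Y ∘ (del X ⊗ idm Y)).

Lemma proj2E (X Y : C) : proj2 X Y = lunit Y ∘ (del X ⊗ idm Y).
Proof. by rewrite /proj2 -lock. Qed.

Lemma proj2_nat (X Y X' Y' : C) (f : X ~> X') (g : Y ~> Y') :
  proj2 X' Y' ∘ (f ⊗ g) = g ∘ proj2 X Y.
Proof.
rewrite !proj2E comp_assoc -lunit_nat -!comp_assoc -!tensm_comp del_comp.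
by rewrite !comp_id_l comp_id_r.
Qed.

Lemma proj2_pair (W X Y : C) (f : W ~> X) (g : W ~> Y) : proj2 X Y ∘ pair f g = g.
Proof. by rewrite proj2E -comp_assoc tensm_pair del_comp comp_id_l lunit_pair. Qed.

Lemma deterministic_proj2 (X Y : C) : deterministic (proj2 X Y).
Proof.
(* After [lunit I], both sides are morphisms into the terminal object [I]. *)
have copy_del : (del X ⊗ del X) ∘ copy X = lunitV I ∘ del X.
  apply: (cancel_left (lunitK I)).
  by rewrite (del_unique (_ ∘ (_ ∘ del X))); apply: del_unique.
rewrite /deterministic copy_tens !proj2E tensm_comp [RHS]comp_assoc.
rewrite -(comp_assoc (lunit Y ⊗ lunit Y)) -swap_middle_nat.
rewrite (comp_assoc (lunit Y ⊗ lunit Y)) swap_middle_unit.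
rewrite -!comp_assoc -tensm_comp copy_del tensm_id comp_id_l -tensm_comp.
rewrite (comp_assoc (lunit I)) lunitVK !comp_id_l.
rewrite comp_assoc -lunit_nat -comp_assoc -tensm_comp.
by rewrite comp_id_l comp_id_r.
Qed.

(** The joint morphism [Θ ~> A ⊗ (Θ ⊗ A)] of [q], the parameter and [q] again. *)
Definition graph (T A : C) (q : T ~> A) : T ~> A ⊗ (T ⊗ A) :=
  locked (swap_left T A A ∘ pair (idm T) (copy A ∘ q)).

Lemma graphE (T A : C) (q : T ~> A) :
  graph q = swap_left T A A ∘ pair (idm T) (copy A ∘ q).
Proof. by rewrite /graph -lock. Qed.

Lemma graph_proj2 (T A : C) (q : T ~> A) :
  (idm A ⊗ proj2 T A) ∘ graph q = copy A ∘ q.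
Proof.
rewrite graphE !proj2E tensm_idl_comp -comp_assoc.
rewrite (reassoc (eq_sym (swap_left_nat _ _ _))) -comp_assoc tensm_id tensm_pair.
by rewrite comp_id_l comp_id_r (reassoc (swap_left_unit _ _)) lunit_pair.
Qed.

Lemma proj2_graph (T A : C) (q : T ~> A) : proj2 A (T ⊗ A) ∘ graph q = pair (idm T) q.
Proof.
rewrite graphE !proj2E -comp_assoc -(tensm_id T A).
rewrite (reassoc (eq_sym (swap_left_nat _ _ _))) -comp_assoc tensm_pair.
rewrite (reassoc (lunit_swap_left _ _)) tensm_pair !comp_id_l.
by rewrite !comp_assoc copy_del_l comp_id_l.
Qed.

Lemma graph_swap (T A : C) (q : T ~> A) :
  (idm A ⊗ swap T A) ∘ graph q = assoc A A T ∘ (copy A ⊗ idm T) ∘ pair q (idm T).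
Proof.
rewrite graphE comp_assoc swap_left_swap -!comp_assoc swap_pair tensm_pair.
by rewrite comp_id_l.
Qed.

(** Copying [T ⊗ A] duplicates the parameter and the value of [q]; coassociativity pulls the extra
    parameter to the front, and what remains is [graph q]. *)
Lemma copy_graph (T A : C) (q : T ~> A) :
  copy (T ⊗ A) ∘ pair (idm T) q = assocV T A (T ⊗ A) ∘ pair (idm T) (graph q).
Proof.
rewrite copy_tens swap_middleE -!comp_assoc tensm_pair comp_id_r.
by rewrite {1}copy_pair assoc_pair tensm_pair comp_id_l -graphE.
Qed.

(* Both sides of the almost sure equality are obtained, up to an isomorphism,
   by pairing the two sides of the right-hand equation with the identity. *)
Lemma as_eq_graph (T A Y : C) (q : T ~> A) (f g : T ⊗ A ~> Y) :
  as_eq (pair (idm T) q) f g <-> (idm A ⊗ f) ∘ graph q = (idm A ⊗ g) ∘ graph q.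
Proof.
have E (k : T ⊗ A ~> Y) : (idm (T ⊗ A) ⊗ k) ∘ copy (T ⊗ A) ∘ pair (idm T) q
    = assocV T A Y ∘ pair (idm T) ((idm A ⊗ k) ∘ graph q).
  rewrite -comp_assoc copy_graph -tensm_id (reassoc (eq_sym (assocV_nat _ _ _))).
  by rewrite -comp_assoc tensm_pair comp_id_l.
rewrite /as_eq !E; split=> [H | -> //].
move/(cancel_left (assocVK _ _ _)): H => H.
by rewrite -[LHS](proj2_pair (idm T)) H proj2_pair.
Qed.

End Markov.

(** * Algebras, conditionals and dilations in terms of [graph] *)

Section Dilation.
Variables (C : markov_category) (R : representation C).

Lemma is_dilation_graph (A T : C) (e : dist R A ~> A) (q : T ~> A) (t : T ⊗ A ~> A) :
  is_dilation e q t <-> (idm A ⊗ (e ∘ sharp R t)) ∘ graph q = copy A ∘ q.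
Proof.
rewrite /is_dilation graphE swap_leftE pairE -!comp_assoc.
by rewrite (reassoc (eq_sym (tensm_idl_comp _ _ _))).
Qed.

Lemma sharp_det (X Y : C) (f : det_hom X Y) : sharp R f = det_comp (delta R Y) f.
Proof.
apply: (samp_inj (R := R)); rewrite samp_sharp /= comp_assoc samp_sharp.
by rewrite comp_id_l.
Qed.

(** Both sides factor through [sharp R c], which lands in [P (P A)]: the left via the multiplication
    [P samp], the right via [P e]. The algebra law says that [e] equalizes these two. *)
Lemma algebra_sharp (A X : C) (e : det_hom (dist R A) A) (c : X ~> dist R A) :
  is_algebra (T := dist_monad R) e -> e ∘ sharp R (samp R A ∘ c) = e ∘ sharp R (e ∘ c).
Proof.
move=> [_ /(f_equal (@det_mor _ _ _)) /= law].
have E (Y : C) (f : dist R A ~> Y) :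
    sharp R (f ∘ c) = det_comp (dist_map R f) (sharp R c).
  apply: (samp_inj (R := R)); rewrite samp_sharp /= comp_assoc samp_dist_map.
  by rewrite -comp_assoc samp_sharp.
by rewrite !E /= !comp_assoc law.
Qed.

Lemma algebra_delta (A : C) (e : det_hom (dist R A) A) :
  is_algebra (T := dist_monad R) e -> e ∘ delta R A = idm A.
Proof. by move=> [/(f_equal (@det_mor _ _ _))]. Qed.

(** The symmetry appears because a conditional takes [A] before the parameter, while [graph] outputs
    the parameter first. *)
Lemma conditional_graph (A Y T : C) (f : T ~> A ⊗ Y) (c : A ⊗ T ~> Y) :
  is_conditional f c ->
  f = (idm A ⊗ (c ∘ swap T A)) ∘ graph (runit A ∘ (idm A ⊗ del Y) ∘ f).
Proof.
move=> {1}->.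
rewrite tensm_idl_comp -[RHS]comp_assoc graph_swap pairE.
by rewrite -!comp_assoc.
Qed.

Lemma as_proj2_dilation (A T : C) (e : det_hom (dist R A) A) (q : T ~> A)
    (c : T ⊗ A ~> dist R A) :
  as_compatible R -> is_algebra (T := dist_monad R) e ->
  (idm A ⊗ (e ∘ c)) ∘ graph q = copy A ∘ q -> is_dilation e q (samp R A ∘ c).
Proof.
(* Writing [copy A ∘ q] through [proj2] makes the hypothesis an almost sure equality of [e ∘ c] and
   [proj2], to which compatibility applies. *)
move=> Rcompat He; rewrite -{1}graph_proj2 => /as_eq_graph /Rcompat /as_eq_graph.
rewrite (sharp_det (DetHom (deterministic_proj2 T A))) /= => H.
apply/is_dilation_graph; rewrite algebra_sharp // tensm_idl_comp -comp_assoc H.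
by rewrite comp_assoc -tensm_idl_comp comp_assoc algebra_delta // comp_id_l graph_proj2.
Qed.

End Dilation.

Theorem proposition4p5 (C : markov_category) (R : representation C)
    (Rcompat : as_compatible R) (Ccond : has_conditionals C)
    (A : C) (e : det_hom (dist R A) A) (He : is_algebra (T := dist_monad R) e)
    (Theta : C) (p q : Theta ~> A) :
  (exists r : Theta ~> dist R A, samp R A ∘ r = p /\ e ∘ r = q) <->
  (exists t : Theta ⊗ A ~> A,
     is_dilation e q t /\ t ∘ (idm Theta ⊗ q) ∘ copy Theta = p).
Proof.
split=> [[r [rp rq]] | [t [tq tp]]].
- have [c] := Ccond _ _ _ (pair e (idm _) ∘ r).
  (* The first marginal of [pair e id ∘ r] is [e ∘ r = q], so the graph in the disintegration is
     that of [q]. *)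
  move/conditional_graph.
  rewrite (comp_assoc (runit A ∘ _)) -(comp_assoc (runit A)) tensm_pair.
  rewrite comp_id_l comp_id_r runit_pair rq.
  move: (c ∘ swap Theta A) => {}c fc.
  exists (samp R A ∘ c); split.
    apply: as_proj2_dilation => //.
    rewrite tensm_idl_comp -comp_assoc -fc comp_assoc tensm_pair comp_id_l comp_id_r.
    (* Determinism of [e] turns [pair e e] into [copy A ∘ e]. *)
    by rewrite pairE -(det_morP e) -comp_assoc rq.
  (* The second marginal of [fc] recovers [r] as [c ∘ pair id q]; sampling then gives [p]. *)
  have /(f_equal (comp (proj2 _ _))) := fc.
  rewrite !comp_assoc proj2_pair proj2_nat comp_id_l => rE.
  by rewrite -rp rE -!comp_assoc proj2_graph pairE.
- exists (sharp R t ∘ pair (idm Theta) q); split.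
    by rewrite comp_assoc samp_sharp -tp pairE comp_assoc.
  move/is_dilation_graph/(f_equal (comp (proj2 _ _))): tq.
  rewrite !comp_assoc proj2_nat -!comp_assoc proj2_graph => ->.
  by rewrite proj2E comp_assoc copy_del_l comp_id_l.
Qed.
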